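(* Let $G$ be a finite $5$-regular graph (multiple edges allowed) which has the triangle property and in which every edge $e$ is unremovable, i.e. for every edge $e$ of $G$ the graph $G-e$ does not have the triangle property. Then $G$ is optimal, i.e. the number of triangles of $G$ equals the number of vertices of $G$.
   Context: Graphs may have multiple edges. A triangle is a set of three distinct vertices with a choice of one edge joining each pair of them (so multiple edges give several triangles on the same vertex set; loops are in no triangle). A graph has the triangle property if every edge lies in at least one triangle. Every $5$-regular graph on $2n$ vertices with the triangle property has at least $2n$ triangles; such a graph with exactly $2n$ triangles is called optimal. An edge $e$ of a graph $G$ with the triangle property is unremovable if $G-e$ (delete the edge $e$, keep all vertices) does not have the triangle property. *)

(* Defs.v *)
From HB Require Import structures.
From mathcomp Require Import all_boot.
Set Implicit Arguments. Unset Strict Implicit. Unset Printing Implicit Defensive.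

(* Finite multigraphs: parallel edges are distinct elements of [edge] with the
   same set of ends; an edge with a singleton set of ends is a loop. *)
Record mgraph := MGraph {
  vertex : finType;
  edge : finType;
  ends : edge -> {set vertex};
  ends_card : forall e, 0 < #|ends e| <= 2
}.

Definition del_edge (G : mgraph) (e : edge G) : mgraph :=
  @MGraph (vertex G) {f : edge G | f != e}
    (fun f => ends (val f)) (fun f => ends_card (val f)).

(* The second summand makes a loop contribute 2 to the degree. *)
Definition degree (G : mgraph) (v : vertex G) : nat :=
  #|[set e : edge G | v \in ends e]| + #|[set e : edge G | ends e == [set v]]|.

Definition regular (k : nat) (G : mgraph) : Prop :=
  forall v : vertex G, degree v = k.

(* A triangle is a pair t = (vertex set, set of chosen edges): t.2 has exactly
   one edge joining each pair of vertices of t.1, and no other edge. *)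
Definition is_triangle (G : mgraph) (t : {set vertex G} * {set edge G}) : bool :=
  [&& #|t.1| == 3,
      [forall e in t.2, (#|ends e| == 2) && (ends e \subset t.1)]
    & [forall A : {set vertex G}, (#|A| == 2) && (A \subset t.1) ==>
        (#|[set e in t.2 | ends e == A]| == 1)]].

Definition ntriangles (G : mgraph) : nat := #|[set t | @is_triangle G t]|.

Definition triangle_property (G : mgraph) : Prop :=
  forall e : edge G,
    exists t : {set vertex G} * {set edge G}, is_triangle t /\ e \in t.2.

Definition unremovable (G : mgraph) (e : edge G) : Prop :=
  ~ triangle_property (del_edge e).

Definition optimal (G : mgraph) : Prop :=
  [/\ regular 5 G, triangle_property G & ntriangles G = #|vertex G|].

(* Main.v *)
Require Import Defs.
From mathcomp Require Import all_boot.

(** If [e] is unremovable, some other edge [f] has all its triangles through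
    [e]; replacing [e] by a parallel edge in such a triangle would avoid [e], so
    the graph is simple. Every edge [xy] then lies in a triangle [xyz] in which
    [xz] or [yz] lies in no other triangle.

    In the link of a vertex [x], a graph on five vertices without isolated
    vertices, the degree of [u] is the number of triangles on [xu], and every
    vertex of degree at least two has a neighbour of degree one (a leaf). Let [K]
    and [L] count the leaves of the link whose neighbour is, respectively is not,
    a leaf. Such a link has [K <= L], and [K = L] only if it has three edges. If
    [u] is a leaf with non-leaf neighbour [w] in the link of [x], then [x] and [w]
    are adjacent leaves in the link of [u], so the sum of [L] over all vertices is
    at most that of [K]. Hence [K = L] everywhere, every vertex lies in exactly
    three triangles, and there are as many triangles as vertices. *)

Set Implicit Arguments. Unset Strict Implicit. Unset Printing Implicit Defensive.

(** * Leaves in a graph on five vertices *)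

Section LinkOfOrderFive.

Variables (T : eqType) (r : rel T).
Hypotheses (r_sym : symmetric r) (r_irr : irreflexive r).

(** A computable quantifier over [bool]: nested uses yield one closed term that evaluation
    decides. *)
Let all_bool (P : bool -> bool) := P true && P false.

Let all_boolP (P : bool -> bool) : all_bool P -> forall b, P b.
Proof. by case/andP=> ? ? []. Qed.

(* The ten adjacencies inside [s] are enumerated. *)
Lemma link5_counts (s : seq T) (d : T -> nat)
    (k := \sum_(u <- s) \sum_(w <- s) [&& r u w, d u == 1 & d w == 1])
    (l := \sum_(u <- s) \sum_(w <- s) [&& r u w, d u == 1 & d w != 1]) :
    (forall u, d u = count (r u) s) -> size s = 5 -> all (fun u => 0 < d u) s ->
    all (fun u => (d u == 1) || has (fun w => r u w && (d w == 1)) s) s ->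
  (k <= l) && ((k == l) ==> (\sum_(u <- s) d u == 6)).
Proof.
case: s @k @l => [//|a [//|b [//|c [//|x [//|e [|//]]]]]] k l dE _.
(* The two conditions become premises inside the boolean goal, so that they are evaluated along with
   it. *)
move=> P1 P2; apply: (implyP (implyP _ P1)) P2 => {P1}.
rewrite /k /l !big_cons !big_nil /= !dE /= !r_irr.
rewrite (r_sym b a) (r_sym c a) (r_sym x a) (r_sym e a) (r_sym c b) (r_sym x b).
rewrite (r_sym e b) (r_sym x c) (r_sym e c) (r_sym e x).
move: (r a b); apply: all_boolP; move: (r a c); apply: all_boolP.
move: (r a x); apply: all_boolP; move: (r a e); apply: all_boolP.
move: (r b c); apply: all_boolP; move: (r b x); apply: all_boolP.
move: (r b e); apply: all_boolP; move: (r c x); apply: all_boolP.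
move: (r c e); apply: all_boolP; move: (r x e); apply: all_boolP.
by vm_compute.
Qed.

End LinkOfOrderFive.

(** * Counting ordered triangles in a tight 5-regular simple graph *)

Section SimpleGraph.

Variables (V : finType) (r : rel V).
Hypotheses (r_sym : symmetric r) (r_irr : irreflexive r).

(** For adjacent [x] and [y], this is the number of triangles on the edge [x y], and also the degree
    of [y] in the link of [x]. *)
Definition codeg (x y : V) := #|[set z | r x z && r y z]|.
Definition tri (x y z : V) := [&& r x y, r x z & r y z].

Lemma codegC x y : codeg x y = codeg y x.
Proof. by apply: eq_card => z; rewrite !inE andbC. Qed.

Lemma codeg1_unique x y z w : codeg x y = 1 -> r x z -> r y z -> r x w -> r y w -> z = w.
Proof.
move=> /eqP/cards1P[a Ea] xz yz xw yw.
have: z \in [set z | r x z && r y z] by rewrite inE xz.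
have: w \in [set z | r x z && r y z] by rewrite inE xw.
by rewrite Ea !inE => /eqP-> /eqP->.
Qed.

Hypothesis r_deg : forall x, #|[set y | r x y]| = 5.
Hypothesis r_tight : forall x y, r x y ->
  exists z, [/\ r x z, r y z & codeg x z = 1 \/ codeg y z = 1].

Lemma codeg_gt0 x y : r x y -> 0 < codeg x y.
Proof.
by case/r_tight=> z [xz yz _]; apply/card_gt0P; exists z; rewrite inE xz.
Qed.

(** The third vertex that [r_tight] provides for [x u] can only be [w], and the alternative
    [codeg x w = 1] is excluded. *)
Lemma tri_codeg1 x u w : tri x u w -> codeg x u = 1 -> codeg x w != 1 -> codeg u w = 1.
Proof.
case/and3P=> xu xw uw c1 c2; have [z [xz uz]] := r_tight xu.
have -> : z = w by apply: codeg1_unique c1 _ _ _ _.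
by case=> // E; rewrite E in c2.
Qed.

(** This gives every non-leaf of the link of [x] a leaf as neighbour. If [r_tight] yields
    [codeg u z = 1] instead, [tri_codeg1] seen from [u] carries the value 1 over to [x z]. *)
Lemma codeg1_neighbour x u : r x u -> codeg x u != 1 ->
  exists w, tri x u w /\ codeg x w = 1.
Proof.
move=> xu c; have [z [xz uz]] := r_tight xu.
have T : tri x u z by rewrite /tri xu xz uz.
case=> E; first by exists z.
exists z; split=> //.
have T' : tri u z x by rewrite /tri uz (r_sym u) (r_sym z) xu xz.
by rewrite codegC (tri_codeg1 T') // codegC.
Qed.

(** A leaf [u] of the link has just one neighbour [w] there, so these sums over pairs count
    leaves. *)
Let K x := \sum_u \sum_w [&& tri x u w, codeg x u == 1 & codeg x w == 1].
Let L x := \sum_u \sum_w [&& tri x u w, codeg x u == 1 & codeg x w != 1].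

Lemma sum_link x (F : V -> V -> bool) (s := enum [set y | r x y]) :
  \sum_u \sum_w (tri x u w && F u w) = \sum_(u <- s) \sum_(w <- s) (r u w && F u w).
Proof.
rewrite /s big_enum /= [RHS]big_mkcond /=; apply: eq_bigr => u _.
rewrite inE /tri; case: (r x u); last by rewrite big1.
rewrite big_enum /= [RHS]big_mkcond /=; apply: eq_bigr => w _.
by rewrite inE; case: (r x w).
Qed.

Lemma codeg_link x u : codeg x u = count (r u) (enum [set y | r x y]).
Proof.
rewrite /codeg cardE -size_filter; apply/eqP; rewrite -uniq_size_uniq ?enum_uniq //.
  by rewrite filter_uniq ?enum_uniq.
by move=> z; rewrite mem_filter !mem_enum !inE andbC.
Qed.

(** This is [link5_counts] for the link of [x]; the 6 stands for three link edges, each in two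
    orders. *)
Lemma link_leaves x :
  (K x <= L x) && ((K x == L x) ==> (\sum_u \sum_w tri x u w == 6)).
Proof.
set s := enum [set y | r x y].
have ms u : (u \in s) = r x u by rewrite mem_enum inE.
have cE u : codeg x u = count (r u) s by exact: codeg_link.
have -> : \sum_u \sum_w tri x u w = \sum_(u <- s) codeg x u.
  transitivity (\sum_u \sum_w (tri x u w && true)).
    by do 2![apply: eq_bigr => ? _]; rewrite andbT.
  rewrite (sum_link x (fun _ _ => true)); apply: eq_bigr => u _.
  by rewrite cE -sum1_count [RHS]big_mkcond /=; apply: eq_bigr => w _; rewrite andbT; case: (r u w).
rewrite /K /L.
rewrite (sum_link x (fun u w => (codeg x u == 1) && (codeg x w == 1))).
rewrite (sum_link x (fun u w => (codeg x u == 1) && (codeg x w != 1))) -/s.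
apply: link5_counts => //.
- by rewrite -cardE r_deg.
- by apply/allP => u; rewrite ms; apply: codeg_gt0.
apply/allP => u; rewrite ms => xu.
have [//|/= c] := boolP (codeg x u == 1).
have [w [/and3P[_ xw uw] cw]] := codeg1_neighbour xu c.
by apply/hasP; exists w; rewrite ?ms // uw cw.
Qed.

Lemma sum_leaves : \sum_x L x <= \sum_x K x.
Proof.
(* After the exchange, the term of [L x] at [u], [w] is compared with the term of [K u] at [x],
   [w]. *)
rewrite /K /L [X in _ <= X]exchange_big /=.
apply: leq_sum => x _; apply: leq_sum => u _; apply: leq_sum => w _.
case: (boolP [&& _, _ & _]) => // /and3P[T /eqP c1 c2].
have /and3P[xu xw uw] := T.
by rewrite (tri_codeg1 T c1 c2) codegC c1 /tri r_sym xu uw xw.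
Qed.

Lemma card_tri : \sum_x \sum_u \sum_w tri x u w = 6 * #|V|.
Proof.
have leKL x (_ : true) : K x <= L x ?= iff (K x == L x).
  by apply/leqifP; have /andP[] := link_leaves x; rewrite leq_eqVlt; case: eqVneq.
(* A sum of inequalities is an equality only if each of them is; [sum_leaves] supplies equality of
   the totals. *)
have LI := leqif_sum leKL.
have : \sum_x K x == \sum_x L x by rewrite eqn_leq LI.1 sum_leaves.
rewrite LI.2 => /forallP E.
rewrite (eq_bigr (fun => 6)) ?sum_nat_const 1?mulnC // => x _.
by have /andP[_] := link_leaves x; rewrite (implyP (E x) isT) => /eqP.
Qed.

End SimpleGraph.

(** * Pairs and orderings in three-element sets *)

Lemma set2_inj (T : finType) (x : T) :
  {in [pred y | x != y] &, injective (fun y => [set x; y])}.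
Proof.
move=> y z; rewrite !inE => xy xz /setP/(_ y).
by rewrite !inE eqxx orbT eq_sym (negbTE xy) => /esym/eqP.
Qed.

Lemma subset3_pair (T : finType) (x u w : T) (A : {set T}) : #|A| = 2 ->
  A \subset [set x; u; w] -> [\/ A = [set x; u], A = [set x; w] | A = [set u; w]].
Proof.
move/eqP/cards2P=> [a [b [ab ->]]]; rewrite subUset !sub1set !inE -!orbA.
case/andP=> /or3P[] /eqP Ea /or3P[] /eqP Eb; subst; rewrite ?eqxx // in ab *;
  by [apply: Or31; rewrite // setUC | apply: Or32; rewrite // setUC
     | apply: Or33; rewrite // setUC].
Qed.

(** The vertices [x], [u], [w] are chosen from [A] in turn, in 3, 2 and 1 ways. *)
Lemma sum_orderings (V : finType) (A : {set V}) : #|A| = 3 ->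
  \sum_x \sum_u \sum_w (A == [set x; u; w]) = 6.
Proof.
move=> A3.
have E x u w : (A == [set x; u; w] :> {set V}) =
    [&& x \in A, u \in A :\ x & w \in A :\ x :\ u].
  apply/eqP/and3P => [AE|[xA uA wA]].
    have xu : u != x.
      by apply/eqP => ux; move: A3; rewrite AE ux setUid cards2; case: (_ != _).
    have xw : w != x.
      apply/eqP => ux; move: A3; rewrite AE ux setUAC setUid cards2.
      by case: (_ != _).
    have uw : w != u.
      by apply/eqP => ux; move: A3; rewrite AE ux -setUA setUid cards2; case: (_ != _).
    by rewrite AE !inE !eqxx xu xw uw !orbT.
  apply/esym/eqP; rewrite eqEcard A3.
  move: uA wA; rewrite !inE => /andP[ux uA] /and3P[wu wx wA].
  rewrite -setUA cardsU1 cards2 !inE !negb_or eq_sym ux eq_sym wx eq_sym wu /=.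
  rewrite andbT; apply/subsetP => y; rewrite !inE => /or3P[] /eqP-> //.
under eq_bigr => x _ do under eq_bigr => u _ do under eq_bigr => w _ do rewrite E.
transitivity (\sum_(x in A) \sum_(u in A :\ x) \sum_(w in A :\ x :\ u) 1).
  rewrite [RHS]big_mkcond; apply: eq_bigr => x _; case: ifP => _ /=; last by rewrite big1 // => ? _; rewrite big1.
  rewrite [RHS]big_mkcond; apply: eq_bigr => u _; case: ifP => _ /=; last by rewrite big1.
  by rewrite [RHS]big_mkcond; apply: eq_bigr => w _; case: ifP.
have F x : x \in A -> \sum_(u in A :\ x) \sum_(w in A :\ x :\ u) 1 = 2.
  move=> xA; have A2 : #|A :\ x| = 2 by move: A3; rewrite (cardsD1 x) xA => -[].
  rewrite -[2]A2 -sum1_card; apply: eq_bigr => u uA.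
  by rewrite sum1_card; move: A2; rewrite (cardsD1 u) uA => -[].
by rewrite (eq_bigr _ F) sum_nat_const A3.
Qed.

(** * From unremovable edges to a tight simple graph *)

Section Multigraph.

Variable G : mgraph.
Implicit Types (e f g : edge G) (t : {set vertex G} * {set edge G}).

Lemma is_triangleP t : reflect
  [/\ #|t.1| = 3,
      forall e, e \in t.2 -> #|ends e| = 2 /\ ends e \subset t.1
    & forall A : {set vertex G}, #|A| = 2 -> A \subset t.1 ->
        exists e, [set g in t.2 | ends g == A] = [set e]]
  (is_triangle t).
Proof.
apply: (iffP and3P) => [[/eqP t3 /forall_inP tE /forallP tA]|[t3 tE tA]]; split.
- by [].
- by move=> e /tE /andP[/eqP].
- by move=> A A2 sA; have := tA A; rewrite A2 sA /= => /cards1P.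
- exact/eqP.
- by apply/forall_inP => e /tE[-> ->]; rewrite eqxx.
- by apply/forallP => A; apply/implyP => /andP[/eqP A2 sA]; apply/cards1P; apply: tA.
Qed.

Lemma triangle_edge t (A : {set vertex G}) :
  is_triangle t -> #|A| = 2 -> A \subset t.1 -> exists2 e, e \in t.2 & ends e = A.
Proof.
case/is_triangleP=> _ _ tA A2 sA; have [e E] := tA A A2 sA.
by have := set11 e; rewrite -E inE => /andP[et /eqP]; exists e.
Qed.

Lemma triangle_ends_inj t : is_triangle t -> {in t.2 &, injective (@ends G)}.
Proof.
case/is_triangleP=> _ tE tA e f et ft ef.
have [e2 sE] := tE e et; have [g E] := tA _ e2 sE.
have: e \in [set g in t.2 | ends g == ends e] by rewrite inE et /=.
have: f \in [set g in t.2 | ends g == ends e] by rewrite inE ft /= ef.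
by rewrite E !inE => /eqP-> /eqP->.
Qed.

Lemma triangle_del_edge e t : is_triangle t -> e \notin t.2 ->
  @is_triangle (del_edge e) (t.1, [set g | val g \in t.2]).
Proof.
case/is_triangleP=> t3 tE tA et; apply/and3P; split=> /=; first by rewrite t3.
  by apply/forall_inP => g; rewrite inE => /tE[-> ->]; rewrite eqxx.
apply/forallP => A; apply/implyP => /andP[/eqP A2 sA].
have [g E] := tA A A2 sA; have := set11 g; rewrite -E inE => /andP[gt gA].
have ge : g != e by apply: contraNneq et => <-.
apply/cards1P; exists (exist _ g ge); apply/setP => h.
have /setP/(_ (val h)) := E; rewrite !inE => ->.
by rewrite -val_eqE.
Qed.

Hypothesis htri : triangle_property G.
Hypothesis hunrem : forall e : edge G, unremovable e.

(** Otherwise every other edge would have a triangle avoiding [e]; these triangles survive in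
    [del_edge e] and give it the triangle property. *)
Lemma unremovable_witness e :
  exists2 f, f != e & forall t, is_triangle t -> f \in t.2 -> e \in t.2.
Proof.
have [/existsP[f /andP[fe /forallP H]]|/existsPn H] := boolP
  [exists f, (f != e) && [forall t, is_triangle t && (f \in t.2) ==> (e \in t.2)]].
  by exists f => // t tt ft; have := H t; rewrite tt ft.
case: (@hunrem e) => -[f fe]; have := H f; rewrite (fe : f != e) /=.
case/forallPn=> t; rewrite negb_imply => /andP[/andP[tt ft] et].
by exists (t.1, [set g : edge (del_edge e) | val g \in t.2]); split;
  [apply: triangle_del_edge | rewrite inE].
Qed.

Lemma card_ends e : #|ends e| = 2.
Proof. by have [t [/is_triangleP[_ tE _] /tE[]]] := htri e. Qed.

Lemma ends_inj : injective (@ends G).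
Proof.
move=> e e' ee'; apply/eqP/negPn/negP => ne.
have [f fe H] := unremovable_witness e; have [t [tt ft]] := htri f.
have et := H t tt ft.
(* Exchanging [e] for its parallel [e'] keeps [f] but loses [e], against the choice of [f]. *)
pose t' := (t.1, e' |: t.2 :\ e).
suff tt' : is_triangle t'.
  by have := H t' tt'; rewrite !inE ft fe eqxx (negbTE ne) orbT => /(_ isT).
have /is_triangleP[t3 tE tA] := tt.
apply/is_triangleP; split=> //=.
  move=> g; rewrite !inE => /orP[/eqP->|/andP[_ /tE] //].
  by rewrite -ee'; apply: tE.
move=> A A2 sA; have [eA|neA] := eqVneq (ends e) A.
  exists e'; apply/setP => g; rewrite !inE -eA.
  have [->|ge' /=] := eqVneq g e'; first by rewrite ee' eqxx.
  apply/negbTE/negP => /andP[/andP[ge gt] /eqP E].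
  by case/eqP: ge; apply: (triangle_ends_inj tt).
have [g E] := tA A A2 sA; exists g; rewrite -E; apply/setP => h; rewrite !inE.
have [->|_] := eqVneq h e'; first by rewrite -ee' (negbTE neA) !andbF.
by have [->|_] := eqVneq h e; first by rewrite (negbTE neA) !andbF.
Qed.

Definition adj (x y : vertex G) := (x != y) && [exists e, ends e == [set x; y]].

Lemma adj_sym : symmetric adj.
Proof. by move=> x y; rewrite /adj eq_sym setUC. Qed.

Lemma adj_irr : irreflexive adj.
Proof. by move=> x; rewrite /adj eqxx. Qed.

Lemma ends_adj e x y : ends e = [set x; y] -> adj x y.
Proof.
move=> E; apply/andP; split; last by apply/existsP; exists e; rewrite E.
by have := card_ends e; rewrite E cards2; case: (x != y).
Qed.

Lemma pair_of_ends e x : x \in ends e -> exists y, ends e = [set x; y].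
Proof.
have /eqP/cards2P[a [b [_ ->]]] := card_ends e.
by rewrite !inE => /orP[] /eqP->; [exists b | exists a; rewrite setUC].
Qed.

(** There are no loops, and both the edges at [x] and the neighbours of [x] correspond bijectively
    to the same two-element sets. *)
Lemma card_adj x : degree x = #|[set y | adj x y]|.
Proof.
rewrite /degree [X in _ + X](_ : _ = 0); last first.
  apply/eqP; rewrite cards_eq0; apply/eqP/setP => e; rewrite !inE.
  by apply/eqP => E; have := card_ends e; rewrite E cards1.
rewrite addn0 -(card_imset _ ends_inj) -(card_in_imset (f := fun y => [set x; y])); last first.
  by move=> y z; rewrite !inE => /andP[xy _] /andP[xz _]; apply: set2_inj.
apply: eq_card => A; apply/imsetP/imsetP => -[].
  move=> e; rewrite inE => /pair_of_ends[y E] ->; exists y => //.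
  by rewrite inE (ends_adj E).
move=> y; rewrite inE => /andP[_ /existsP[e /eqP E]] ->.
by exists e; rewrite ?inE E // !inE eqxx.
Qed.

Lemma tri_card x u w : tri adj x u w -> #|[set x; u; w]| = 3.
Proof.
case/and3P=> /andP[xu _] /andP[xw _] /andP[uw _].
by rewrite -setUA cardsU1 cards2 !inE negb_or xu xw uw.
Qed.

(** Without parallel edges, this is the only possible triangle with vertex set [A]. *)
Definition induced (A : {set vertex G}) := (A, [set e : edge G | ends e \subset A]).

Lemma triangle_induced t : is_triangle t -> t = induced t.1.
Proof.
move=> tt; have /is_triangleP[_ tE _] := tt.
case: t tt tE => A F /= tt tE; congr pair; apply/setP => e; rewrite inE.
apply/idP/idP => [/tE[]//|sE].
by have [f fF /ends_inj <-] := triangle_edge tt (card_ends e) sE.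
Qed.

Lemma triangle_inducedP x u w :
  reflect (#|[set x; u; w]| = 3 /\ is_triangle (induced [set x; u; w])) (tri adj x u w).
Proof.
apply: (iffP idP) => [T|[c3 tt]].
  have c3 := tri_card T; split=> //; apply/is_triangleP; split=> //.
    by move=> e; rewrite inE card_ends.
  move=> A A2 sA; have [e E] : exists e, ends e = A.
    case/and3P: T => /andP[_ /existsP[e1 /eqP E1]] /andP[_ /existsP[e2 /eqP E2]].
    case/andP=> _ /existsP[e3 /eqP E3].
    by case: (subset3_pair A2 sA) => ->; [exists e1 | exists e2 | exists e3].
  exists e; apply/setP => g; rewrite !inE -E (inj_eq ends_inj).
  by have [->|_] := eqVneq g e; rewrite ?andbF // E sA.
have H y z : y != z -> [set y; z] \subset [set x; u; w] -> adj y z.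
  move=> yz /(triangle_edge tt); rewrite cards2 yz => /(_ erefl)[e _].
  exact: ends_adj.
move: c3; rewrite -setUA cardsU1 cards2 !inE negb_or.
case: eqVneq => //= xu; case: eqVneq => //= xw; case: eqVneq => //= uw _.
by apply/and3P; split; apply: H => //; rewrite subUset !sub1set !inE !eqxx ?orbT.
Qed.

Lemma sum_tri : \sum_x \sum_u \sum_w tri adj x u w = 6 * ntriangles G.
Proof.
(* Double counting of triangles with an ordering of their vertices: only [induced [set x; u; w]] can
   contribute for given [x], [u], [w]. *)
transitivity (\sum_x \sum_u \sum_w \sum_(t | @is_triangle G t) (t.1 == [set x; u; w])).
  apply: eq_bigr => x _; apply: eq_bigr => u _; apply: eq_bigr => w _.
  case: (boolP (tri adj x u w)) => [/triangle_inducedP[c3 tt]|nt].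
    rewrite (bigD1 (induced [set x; u; w])) //= eqxx big1 // => t /andP[/triangle_induced tE nE].
    by apply/eqP; rewrite eqb0; apply: contraNneq nE => E; rewrite tE E.
  rewrite big1 // => t tt; case: eqVneq => // E; case/negP: nt.
  by apply/triangle_inducedP; rewrite -E -triangle_induced //; split=> //; case/is_triangleP: tt.
under eq_bigr => x _ do under eq_bigr => u _ do rewrite exchange_big /=.
under eq_bigr => x _ do rewrite exchange_big /=.
rewrite exchange_big /= (eq_bigr (fun => 6)); last first.
  by move=> t /is_triangleP[t3 _ _]; apply: sum_orderings.
by rewrite sum_nat_const mulnC /ntriangles cardsE.
Qed.

(** A common neighbour [w] of [x] and [z] makes a triangle through [f], hence through [e]; so [y] is
    one of its vertices, and it must be [w]. *)
Lemma codeg1_of_witness e f x y z : ends e = [set x; y] -> ends f = [set x; z] -> adj y z ->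
  (forall t, is_triangle t -> f \in t.2 -> e \in t.2) -> codeg adj x z = 1.
Proof.
move=> eE fE yz H; have xy := ends_adj eE; have xz := ends_adj fE.
apply/eqP/cards1P; exists y; apply/setP => w; rewrite !inE.
apply/andP/eqP => [[xw zw]|->]; last by rewrite xy adj_sym.
have /triangle_inducedP[_ tt] : tri adj x z w by rewrite /tri xz xw zw.
have := H _ tt; rewrite !inE eE fE !subUset !sub1set !inE !eqxx !orbT => /(_ isT) /=.
case/andP: xy => xy _; case/andP: yz => yz _.
by rewrite [y == x]eq_sym (negbTE xy) (negbTE yz) /= => /eqP.
Qed.

(** A triangle through the witness [f] of [e] also contains [e]. Its third vertex is [z], and [f],
    being different from [e], joins [z] to [x] or to [y]. *)
Lemma adj_tight x y : adj x y ->
  exists z, [/\ adj x z, adj y z & codeg adj x z = 1 \/ codeg adj y z = 1].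
Proof.
case/andP=> xy /existsP[e /eqP eE].
have [f fe H] := unremovable_witness e; have [t [tt ft]] := htri f.
have et := H t tt ft; have /is_triangleP[t3 tE _] := tt.
have [_] := tE e et; rewrite eE subUset !sub1set => /andP[xt yt].
have /cards1P[z zE] : #|t.1 :\ x :\ y| == 1.
  by move: t3; rewrite (cardsD1 x) xt (cardsD1 y) !inE [y == x]eq_sym xy yt => /eqP.
have tE3 : t.1 = [set x; y; z].
  apply/setP => w; have /setP/(_ w) := zE; rewrite !inE => <-.
  case: (eqVneq w x) => [->|_]; first by rewrite xt.
  by case: (eqVneq w y) => [->|_]; first by rewrite yt.
have /and3P[_ xz yz] : tri adj x y z.
  by apply/triangle_inducedP; rewrite -tE3 -triangle_induced.
exists z; split=> //; have [_] := tE f ft; rewrite tE3.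
case/(subset3_pair (card_ends f)) => fE.
- by case/eqP: fe; apply: ends_inj; rewrite eE.
- by left; apply: (codeg1_of_witness eE fE).
- right; apply: (codeg1_of_witness _ fE _ H); last exact: xz.
  by rewrite eE setUC.
Qed.

End Multigraph.

Theorem theorem3 (G : mgraph) (hreg : regular 5 G) (htri : triangle_property G)
  (hunrem : forall e : edge G, unremovable e) : optimal G.
Proof.
(* Ordered triangles number six per triangle and six per vertex. *)
split=> //; apply/eqP; rewrite -(eqn_pmul2l (isT : 0 < 6)) -sum_tri //.
rewrite (card_tri (@adj_sym G) (@adj_irr G)) //.
- by move=> x; rewrite -card_adj.
- exact: adj_tight.
Qed.
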